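(* Let $d$ be an odd positive integer with $d \equiv 2 \pmod 3$. Then $\chi(\mathbb{Z}^3, \sqrt{2d}) = 3$.
   Context: For $r>0$ and $S \subseteq \mathbb{R}^n$, $G(S,r)$ denotes the graph whose vertex set is $S$, two points $a,b$ being adjacent if and only if their Euclidean distance $|a-b|$ equals $r$; $\chi(S,r)$ denotes the chromatic number of $G(S,r)$. Here $\mathbb{Z}^3$ is the integer lattice in $\mathbb{R}^3$. *)

(* Defs.v *)
From HB Require Import structures.
From mathcomp Require Export all_boot all_order all_algebra.
From mathcomp Require Export all_classical reals.

Set Implicit Arguments.
Unset Strict Implicit.
Unset Printing Implicit Defensive.

Import Order.TTheory GRing.Theory Num.Theory.
Local Open Scope classical_set_scope.
Local Open Scope ring_scope.

Record graph := Graph { vertex : Type; adj : vertex -> vertex -> Prop }.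

Definition proper_coloring (G : graph) (C : Type) (c : vertex G -> C) : Prop :=
  forall a b : vertex G, adj a b -> c a <> c b.

Definition colorable (G : graph) (k : nat) : Prop :=
  exists c : vertex G -> 'I_k, proper_coloring c.

(* As a relation rather than a function, because a graph need not be
   colorable with finitely many colors. *)
Definition is_chromatic_number (G : graph) (k : nat) : Prop :=
  colorable G k /\ forall m : nat, colorable G m -> (k <= m)%N.

(* The library norm on row vectors is the sup norm, hence this definition. *)
Definition edist (R : realType) (n : nat) (a b : 'rV[R]_n) : R :=
  Num.sqrt (\sum_(i < n) (a ord0 i - b ord0 i) ^+ 2).

(* [set_type S] is the subtype of the points belonging to [S]. *)
Definition dist_graph (R : realType) (n : nat) (S : set 'rV[R]_n) (r : R) :
    graph :=
  @Graph (set_type S) (fun a b => edist (val a) (val b) = r).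

Definition int_lattice (R : realType) (n : nat) : set 'rV[R]_n :=
  [set v | forall i : 'I_n, v ord0 i \is a Num.int].
Arguments int_lattice : clear implicits.

(* Main.v *)
Require Import Defs.
From mathcomp Require Import all_boot all_order all_algebra.
From mathcomp Require Import all_classical reals.
From mathcomp Require Import zify ring.

(** Colouring a point by its coordinate sum modulo 3 is proper: as [2d] is [1]
    modulo 3, exactly one coordinate of an edge is nonzero modulo 3.

    If [x^2 + y^2 + z^2 = 2d] with [x] odd, a 2-colouring is invariant under
    translation by [2x] along each axis (compare the steps [(x, y, z)] and
    [(-x, y, z)]).  With [s = x + y + z], which is even, three cyclically
    permuted steps translate by [(s, s, s)]; repeating this [|x|] times is an odd
    walk whose total translation is a multiple of [2x] in each coordinate, so no
    2-colouring exists.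

    It remains to write [2d] as a sum of three squares, i.e. the odd number [d]
    as [a^2 + b^2 + 2z^2].  This is done by an elementary class number relation.
    Let [t k] count the [(a, b, z)] with [a^2 + b^2 + 2z^2 = k], and [c k] the
    [(a, b, r)] with [a^2 - b^2 - 2r^2 = k] and [2|r| < a - |b|]; clearly
    [c k > 0] for [k] odd.  For [m] odd, the sum over [w] of [t (m - 2w^2)] is
    [4 sigma m] and the sum of [c (m - 2w^2)] is [sigma m], whence [t = 4c] by
    induction.

    The first sum counts representations by [a^2 + b^2 + 2z^2 + 2w^2], a quarter
    of those of [4m] by four odd squares.  The latter number is [16 sigma m],
    because both sides satisfy the recurrence that expresses that the five
    coordinates of a sum of five odd squares are interchangeable; for [sigma]
    this is an identity between sums over [w^2 + 4de = M], which follows from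
    the substitution [(w, d, e) -> (w + 2d, d, e - w - d)].

    The second sum counts matrices [[s, -2u], [v, h]] of determinant [m] with
    [|u - v| < min s h] and [u = v] modulo 2.  Each sublattice of index [m] in
    [Z^2] has exactly one basis of this kind, and there are [sigma m] such
    sublattices, one for each triangular matrix with [u = 0]. *)

Set Implicit Arguments.
Unset Strict Implicit.
Unset Printing Implicit Defensive.
Import Order.TTheory GRing.Theory Num.Theory.
Local Open Scope ring_scope.

(** * Reduction of lattice bases *)

(* [(a, b, w, r)] encodes the basis [(s, -2u)], [(v, h)] with [s = a + b],
   [h = a - b], [u = w - r] and [v = w + r]; [qform] is its determinant
   [s h + 2 u v].  Bases are taken up to sign, with [s > 0]. *)
Definition state := (int * int * int * int)%type.
Definition qform (x : state) : int := let: (a, b, w, r) := x in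
  a * a - b * b + 2 * w * w - 2 * r * r.
(** The reflection [(X, Y) -> (X, -Y)] of the plane, followed by negating the second basis vector.
    It halves the case analyses below. *)
Definition mirror (x : state) : state := let: (a, b, w, r) := x in (a, b, - w, - r).
Definition unsign (x : state) : state :=
  let: (a, b, w, r) := x in if 0 < a + b then x else (- a, - b, - w, - r).
(* The change of basis [(l1, l2) -> (l1, l2 - 2 l1)]. *)
Definition shear (x : state) : state :=
  let: (a, b, w, r) := x in
  (a + 2 * (w - r), b - 2 * (w - r), w - (a + b), r - (a + b)).
Definition unshear (x : state) : state := mirror (shear (mirror x)).
(* The change of basis [(l1, l2) -> (l1 - 2 l2, l1 - l2)]. *)
Definition turn (x : state) : state :=
  let: (a, b, w, r) := x in unsign (b - 2 * w, a - 2 * r, a - r, b - w).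
Definition unturn (x : state) : state := mirror (turn (mirror x)).
Definition reduced (x : state) : bool := let: (a, b, w, r) := x in
  [&& 2 * r < a - b, - (2 * r) < a - b, 2 * r < a + b & - (2 * r) < a + b].
Definition oddint (n : int) := exists k, n = 2 * k + 1.
Definition valid (x : state) := let: (a, b, w, r) := x in
  [/\ 0 < a + b, oddint (a + b) & 0 < qform x].

(* On the tree of bases with edges [shear] and [turn], orient every edge towards
   the reduced basis: [shears] and [turns] tell when the edge leading out of [x]
   is [shear x] or [turn x].  Uniqueness of the reduced basis only needs that of
   two neighbours one always flows to the other. *)
Definition shears (x : state) : bool := let: (a, b, w, r) := x in
  let s := a + b in let h := a - b in let u := w - r in
  [&& 0 < h, s < 2 * r & 0 < h + 2 * u]
  || [&& h < 0, 0 < u & (s < 2 * r) || (h + 2 * u < 0)].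
Definition turns (x : state) : bool := let: (a, b, w, r) := x in
  let s := a + b in let h := a - b in let u := w - r in
  [&& 0 < h, 0 < r & (s < 2 * r) && (h + 2 * u < 0) || (2 * r < s) && (h < 2 * r)]
  || [&& h < 0, 0 < u, 2 * r < s & 0 < h + 2 * u].
Definition flow (x : state) : state :=
  if shears x then shear x else if shears (mirror x) then unshear x else
  if turns x then turn x else if turns (mirror x) then unturn x else x.

Lemma mirrorK : involutive mirror.
Proof. by move=> [[[a b] w] r]; rewrite /mirror !opprK. Qed.

Lemma qform_mirror x : qform (mirror x) = qform x.
Proof. by case: x => [[[a b] w] r] /=; ring. Qed.

Lemma qform_shear x : qform (shear x) = qform x.
Proof. by case: x => [[[a b] w] r] /=; ring. Qed.

Lemma qform_turn x : qform (turn x) = qform x.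
Proof. by case: x => [[[a b] w] r] /=; rewrite /unsign; case: ifP => _ /=; ring. Qed.

Lemma valid_mirror x : valid x -> valid (mirror x).
Proof.
move=> vx; have := qform_mirror x; move: vx.
by case: x => [[[a b] w] r] [? ? ?] E; split; rewrite ?E.
Qed.

Lemma valid_shear x : valid x -> valid (shear x).
Proof.
move=> vx; have := qform_shear x; move: vx.
case: x => [[[a b] w] r] [? [k Hk] ?] E; split; rewrite ?E //; first lia.
by exists k; lia.
Qed.

Lemma valid_turn x : valid x -> valid (turn x).
Proof.
move=> vx; have := qform_turn x; move: vx.
case: x => [[[a b] w] r] [? [k Hk] ?]; rewrite /turn /unsign; case: ifP => H E;
  split; rewrite ?E //; try lia.
  by exists (k - w - r); lia.
by exists (w + r - k - 1); lia.
Qed.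

(** As [s] is odd, so is [h]; hence [s = 2r] and [h + 2u = 0] cannot occur. The case [h < 0],
    [u = 0] contradicts the positive determinant. In every other sign pattern one end of the edge
    points to the other. *)
Lemma shear_edge x : valid x -> shears x \/ shears (mirror (shear x)).
Proof.
case: x => [[[a b] w] r] /= [H1 [k Hk] H3].
case: (ltrP 0 (a - b)) => Hh; case: (ltrP 0 (w - r)) => Hu;
  case: (ltrP (a + b) (2 * r)) => Hr; case: (ltrP 0 (a - b + 2 * (w - r))) => Hy.
all: try (left; lia); try (right; lia).
all: try (exfalso; nia).
all: try (right; nia).
Qed.

Lemma turn_edge x : valid x -> turns x \/ turns (turn x).
Proof.
case: x => [[[a b] w] r] /= [H1 [k Hk] H3]; rewrite /unsign; case: ifP => Hs /=.
all: case: (ltrP 0 (a - b)) => Hh; case: (ltrP 0 (w - r)) => Hu;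
  case: (ltrP (a + b) (2 * r)) => Hr; case: (ltrP 0 (a - b + 2 * (w - r))) => Hy.
all: try (left; lia); try (right; lia).
all: try (exfalso; nia).
all: case: (ltrP (a - b) (2 * r)) => Hhr; case: (ltrP 0 (b - w)) => Hbw;
  case: (ltrP 0 r) => Hr0; try (left; lia); try (right; lia).
all: try (exfalso; nia).
all: try (right; nia).
Qed.

Lemma shearK : cancel shear unshear.
Proof. by move=> [[[a b] w] r]; rewrite /unshear /=; congr (_, _, _, _); ring. Qed.

Lemma unshearK : cancel unshear shear.
Proof. by move=> x; rewrite -{2}[x]mirrorK -[mirror x]shearK /unshear !mirrorK. Qed.

(** The matrix of this change of basis squares to [-1], and [unsign] removes the sign. *)
Lemma turnK x : valid x -> turn (turn x) = x.
Proof.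
case: x => [[[a b] w] r] /= [H1 [k Hk] H3]; rewrite /unsign.
by case: ifP => H /=; rewrite /unsign; case: ifP => H' /=; try (exfalso; lia);
  congr (_, _, _, _); ring.
Qed.

Lemma shears_mirror x : valid x -> shears x -> shears (mirror x) = false.
Proof. by case: x => [[[a b] w] r] /= [H1 [k Hk] H3]; lia. Qed.

Lemma turns_shears x : valid x -> turns x -> shears x = false.
Proof. by case: x => [[[a b] w] r] /= [H1 [k Hk] H3]; lia. Qed.

Lemma turns_shears_mirror x : valid x -> turns x -> shears (mirror x) = false.
Proof. by case: x => [[[a b] w] r] /= [H1 [k Hk] H3]; lia. Qed.

Lemma turns_mirror x : valid x -> turns x -> turns (mirror x) = false.
Proof. by case: x => [[[a b] w] r] /= [H1 [k Hk] H3]; lia. Qed.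

Lemma flow_shears x : shears x -> flow x = shear x.
Proof. by rewrite /flow => ->. Qed.

Lemma flow_shears_mirror x : valid x -> shears (mirror x) -> flow x = unshear x.
Proof.
move=> /valid_mirror vx gx; rewrite /flow gx.
by have := shears_mirror vx gx; rewrite mirrorK => ->.
Qed.

Lemma flow_turns x : valid x -> turns x -> flow x = turn x.
Proof. by move=> vx gx; rewrite /flow (turns_shears vx) // (turns_shears_mirror vx) // gx. Qed.

Lemma flow_turns_mirror x : valid x -> turns (mirror x) -> flow x = unturn x.
Proof.
move=> /valid_mirror vx gx; rewrite /flow gx (turns_shears vx gx).
have := turns_shears_mirror vx gx; have := turns_mirror vx gx.
by rewrite mirrorK => -> ->.
Qed.

Lemma flow_reduced x : valid x -> reduced x -> flow x = x.
Proof.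
move=> vx rx; suff : [&& ~~ shears x, ~~ shears (mirror x), ~~ turns x & ~~ turns (mirror x)].
  by rewrite /flow => /and4P[/negbTE-> /negbTE-> /negbTE-> /negbTE->].
by case: x vx rx => [[[a b] w] r] /= [H1 [k Hk] H3]; lia.
Qed.

Variant adjacent (x : state) : state -> Prop :=
  | AdjShear : adjacent x (shear x)
  | AdjUnshear : adjacent x (unshear x)
  | AdjTurn : adjacent x (turn x)
  | AdjUnturn : adjacent x (unturn x).

Lemma valid_adjacent x y : valid x -> adjacent x y -> valid y.
Proof.
move=> vx [].
- exact: valid_shear.
- exact/valid_mirror/valid_shear/valid_mirror.
- exact: valid_turn.
- exact/valid_mirror/valid_turn/valid_mirror.
Qed.

Lemma qform_adjacent x y : adjacent x y -> qform y = qform x.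
Proof.
by case; rewrite ?/unshear ?/unturn ?qform_mirror ?(qform_shear, qform_turn) ?qform_mirror.
Qed.

Lemma adjacent_sym x y : valid x -> adjacent x y -> adjacent y x.
Proof.
move=> vx [].
- by rewrite -{2}[x]shearK; constructor.
- by rewrite -{2}[x]unshearK; constructor.
- by rewrite -{2}[x]turnK //; constructor.
- have E : unturn (unturn x) = x.
    by rewrite /unturn !mirrorK turnK ?mirrorK //; apply: valid_mirror.
  by rewrite -{2}E; constructor.
Qed.

Lemma adjacent_mirror x y : adjacent x y -> adjacent (mirror x) (mirror y).
Proof.
case; rewrite ?/unshear ?/unturn ?mirrorK.
- have -> : mirror (shear x) = unshear (mirror x) by rewrite /unshear mirrorK.
  by constructor.
- by constructor.
- have -> : mirror (turn x) = unturn (mirror x) by rewrite /unturn mirrorK.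
  by constructor.
- by constructor.
Qed.

Lemma flow_adjacent x y : valid x -> adjacent x y -> flow x = y \/ flow y = x.
Proof.
move=> vx [].
- case: (shear_edge vx) => [/flow_shears|g]; first by left.
  by right; rewrite (flow_shears_mirror (valid_shear vx)) // shearK.
- have vy : valid (unshear x) by apply/valid_mirror/valid_shear/valid_mirror.
  case: (shear_edge vy) => [/flow_shears|]; rewrite unshearK; first by right.
  by move=> g; left; rewrite flow_shears_mirror.
- case: (turn_edge vx) => [/(flow_turns vx)|g]; first by left.
  by right; rewrite (flow_turns (valid_turn vx)) // turnK.
- have vm := valid_mirror vx; case: (turn_edge vm) => [/(flow_turns_mirror vx)|g].
    by left.
  right; rewrite flow_turns_mirror /unturn ?mirrorK ?turnK ?mirrorK //.
  exact/valid_mirror/valid_turn.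
Qed.

(** * Linked bases and uniqueness of the reduced one *)

Inductive linked (x : state) : state -> Prop :=
  | LinkedRefl : linked x x
  | LinkedStep y z : linked x y -> adjacent y z -> linked x z.

Lemma valid_linked x y : valid x -> linked x y -> valid y.
Proof. by move=> vx; elim=> // ? ? _ vy /valid_adjacent; apply. Qed.

Lemma qform_linked x y : linked x y -> qform y = qform x.
Proof. by elim=> // ? ? _ <- /qform_adjacent. Qed.

Lemma linked_trans x y z : linked x y -> linked y z -> linked x z.
Proof. by move=> xy; elim=> // ? ? _ IH; apply: LinkedStep. Qed.

Lemma linked_adjacent x y : adjacent x y -> linked x y.
Proof. by apply: LinkedStep; apply: LinkedRefl. Qed.

Lemma linked_sym x y : valid x -> linked x y -> linked y x.
Proof.
move=> vx; elim=> [|{}y z xy yx yz]; first exact: LinkedRefl.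
by apply: linked_trans yx; apply/linked_adjacent/adjacent_sym/yz/valid_linked/xy.
Qed.

Lemma linked_mirror x y : linked x y -> linked (mirror x) (mirror y).
Proof.
elim=> [|{}y z _ xy yz]; first exact: LinkedRefl.
exact/(LinkedStep xy)/adjacent_mirror.
Qed.

(** Every basis on a walk from [x] flows to the fixed point [x]: a neighbour [z] of [y] either flows
    to [y], or is the next point on the way from [y] to [x]. A reduced [y] is fixed as well, so it
    can only reach [x] by being [x]. *)
Lemma reduced_unique x y :
  valid x -> linked x y -> reduced x -> reduced y -> x = y.
Proof.
move=> vx xy rx ry; have vy := valid_linked vx xy.
suff [n <-] : exists n, iter n flow y = x.
  by elim: n => //= n ->; rewrite flow_reduced.
elim: xy {ry vy} => [|{}y z xy [n yx] yz]; first by exists 0%N.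
have [zy|zy] := flow_adjacent (valid_linked vx xy) yz; last first.
  by exists n.+1; rewrite iterSr zy.
case: n yx => [|n] /=; last by rewrite -iterS iterSr zy => ?; exists n.
by move=> yx; exists 0%N; rewrite /= -zy yx flow_reduced.
Qed.

Lemma reduced_mirror x : reduced (mirror x) = reduced x.
Proof. by case: x => [[[a b] w] r] /=; lia. Qed.

(** * Existence of a reduced basis *)

Lemma mirror_linked_reduced x :
  (exists2 y, linked (mirror x) y & reduced y) ->
  exists2 y, linked x y & reduced y.
Proof.
case=> y xy ry; exists (mirror y); last by rewrite reduced_mirror.
by rewrite -[x]mirrorK; apply: linked_mirror.
Qed.

Lemma step_linked_reduced x y : adjacent x y ->
  (exists2 z, linked y z & reduced z) -> exists2 z, linked x z & reduced z.
Proof.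
by move=> /linked_adjacent xy [z yz rz]; exists z => //; apply: linked_trans yz.
Qed.

(* The shapes met on the way from a triangular to a reduced basis; along it
   [max s |v|] decreases, except possibly in the last step. *)
Definition descending (x : state) : bool := let: (a, b, w, r) := x in
  let s := a + b in let h := a - b in let u := w - r in let v := w + r in
  [|| [&& 0 < h, 0 <= u, 0 <= v, - s < 2 * r & - h < 2 * r],
      [&& 2 * u < h, 0 <= u, v < 0 & - s < 2 * r]
    | [&& h < 0, 0 < u, - h < 2 * u & u + s < v]].

Lemma descending_reduced x : valid x -> descending x ->
  exists2 y, linked x y & reduced y.
Proof.
case: x => [[[a b] w] r] vx dx.
have [n] : exists n : nat, [&& a + b <= n%:Z, w + r <= n%:Z & - (w + r) <= n%:Z].
  by exists (absz (a + b)%R + absz (w + r)%R)%N; lia.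
elim: n a b w r vx dx => [|n IH] a b w r vx dx Hn.
  by case: vx => ? _ _; lia.
have [rx|nrx] := boolP (reduced (a, b, w, r)).
  by exists (a, b, w, r) => //; apply: LinkedRefl.
have vS := valid_shear vx; have vT := valid_turn vx.
have vT' := valid_turn (valid_mirror vx).
have [H1 [k Hk] H3] := vx.
(* Here [v - u = 2r]: use [shear] if it exceeds [s], [unturn] if it is not positive, and [turn]
   otherwise. *)
have [Hv|Hv] := ltrP (a + b) (w + r - (w - r)).
  apply: (step_linked_reduced (AdjShear _)); apply: IH vS _ _.
    by move: dx nrx => /=; lia.
  by move: dx nrx => /=; lia.
have [Hr|Hr] := ltrP 0 r; last first.
  apply: (step_linked_reduced (AdjUnturn _)); rewrite /unturn.
  apply: mirror_linked_reduced; rewrite mirrorK.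
  move: vT'; rewrite /turn /mirror /unsign; case: ifP => Hs vT'.
    by apply: IH vT' _ _; move: dx nrx => /=; lia.
  apply: mirror_linked_reduced.
  by apply: IH (valid_mirror vT') _ _; move: dx nrx => /=; lia.
apply: (step_linked_reduced (AdjTurn _)).
move: vT; rewrite /turn /unsign; case: ifP => Hs vT.
  by apply: IH vT _ _; move: dx nrx => /=; lia.
have [Hws|Hws] := ltrP (w + r) (a + b).
  apply: mirror_linked_reduced.
  by apply: IH (valid_mirror vT) _ _; move: dx nrx => /=; lia.
(* For [v >= s] the new [s] is [2v - s >= v], so the bound does not drop, but this basis is already
   reduced. *)
eexists; first exact: LinkedRefl.
by move: dx nrx => /=; lia.
Qed.

(** A Hermite normal form: [u = 0], and [v = 2w] is an even number between [-s] and [s]. These even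
    numbers represent every residue modulo the odd number [s] once. *)
Definition triangular (x : state) : bool := let: (a, b, w, r) := x in
  [&& w == r, 2 * w < a + b & - (2 * w) < a + b].

Lemma triangular_reduced x : valid x -> triangular x ->
  exists2 y, linked x y & reduced y.
Proof.
move=> vx tx.
have [dx|dx] : descending x \/ descending (mirror x).
- case: x vx tx => [[[a b] w] r] [H1 [k Hk] /= H3] /= /and3P[/eqP wr]; subst r.
  have : 0 < (a + b) * (a - b) by nia.
  by rewrite pmulr_rgt0 //; have [] := lerP 0 w; [left | right]; lia.
- exact: descending_reduced.
- exact/mirror_linked_reduced/descending_reduced/dx/valid_mirror.
Qed.

(** [shear] and [unshear] keep [u] and change [h] by [4u] and [-4u]. Equality of [|h|] and [2|u|] is
    impossible because [h] is odd. *)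
Lemma linked_small_h a b w r : valid (a, b, w, r) -> w != r ->
  exists a' b' w' r', [/\ linked (a, b, w, r) (a', b', w', r'), w' - r' = w - r
    & (a' - b' < 2 * `|w - r|) /\ (- (a' - b') < 2 * `|w - r|)].
Proof.
move=> vx wr; have [n] : exists n : nat, (absz (a - b)%R <= n)%N by exists (absz (a - b)%R).
elim: n a b w r vx wr => [|n IH] a b w r vx wr Hn.
  by exists a, b, w, r; split=> //; [exact: LinkedRefl | lia].
have [H1 [k Hk] H3] := vx.
have [H|H] : (a - b < 2 * `|w - r|) /\ (- (a - b) < 2 * `|w - r|) \/
    (2 * `|w - r| < a - b) \/ (2 * `|w - r| < - (a - b)).
- lia.
- by exists a, b, w, r; split=> //; exact: LinkedRefl.
have [Hs|Hs] : (a - b) * (w - r) < 0 \/ 0 < (a - b) * (w - r) by nia.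
  have [||a' [b' [w' [r' [L E1 E2]]]]] := IH _ _ _ _ (valid_shear vx); try nia.
  exists a', b', w', r'; split; last 1 [lia | lia].
    exact: (linked_trans (linked_adjacent (AdjShear _))).
have vx' : valid (unshear (a, b, w, r)).
  exact/valid_mirror/valid_shear/valid_mirror.
have [||a' [b' [w' [r' [L E1 E2]]]]] := IH _ _ _ _ vx'; try nia.
exists a', b', w', r'; split; last 1 [lia | lia].
exact: (linked_trans (linked_adjacent (AdjUnshear _))).
Qed.

(** Euclid's algorithm: once [|h| < 2|u|], one of [turn] and [unturn] replaces [u], up to sign, by
    that one of [u + h] and [u - h] which is smaller in absolute value than [u]; [h] is odd, hence
    nonzero. *)
Lemma linked_zero_u a b w r : valid (a, b, w, r) ->
  exists a' b' w', linked (a, b, w, r) (a', b', w', w').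
Proof.
move=> vx; have [n] : exists n : nat, (absz (w - r)%R <= n)%N by exists (absz (w - r)%R).
elim: n a b w r vx => [|n IH] a b w r vx Hn.
  by exists a, b, w; have <- : w = r by [lia]; exact: LinkedRefl.
have [wr|wr] := eqVneq w r.
  by exists a, b, w; rewrite -wr; exact: LinkedRefl.
have [a1 [b1 [w1 [r1 [L1 E1 E2]]]]] := linked_small_h vx wr.
have v1 := valid_linked vx L1; have [H1 [k Hk] H3] := v1.
suff [a2 [b2 [w2 [r2 [A Hu]]]]] : exists a2 b2 w2 r2,
    adjacent (a1, b1, w1, r1) (a2, b2, w2, r2) /\ (absz (w2 - r2)%R <= n)%N.
  have v2 := valid_adjacent v1 A.
  have [a3 [b3 [w3 L3]]] := IH _ _ _ _ v2 Hu; exists a3, b3, w3.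
  exact: linked_trans (LinkedStep L1 A) L3.
have [Hs|Hs] : (0 < a1 - b1 /\ w1 < r1 \/ a1 < b1 /\ 0 < w1 - r1) \/
    (0 < a1 - b1 /\ 0 < w1 - r1 \/ a1 < b1 /\ w1 < r1).
- lia.
- have := AdjTurn (a1, b1, w1, r1); rewrite /turn /unsign; case: ifP => Hc A.
    by do 4!eexists; split; [exact: A | lia].
  by do 4!eexists; split; [exact: A | lia].
- have := AdjUnturn (a1, b1, w1, r1); rewrite /unturn /turn /mirror /unsign.
  case: ifP => Hc A.
    by do 4!eexists; split; [exact: A | lia].
  by do 4!eexists; split; [exact: A | lia].
Qed.

(** When [u = 0], [shear] and [unshear] only change [v] by a multiple of [2s], which brings it
    between [-s] and [s]. *)
Lemma linked_triangular x : valid x -> exists2 y, linked x y & triangular y.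
Proof.
case: x => [[[a b] w] r] vx; have [a1 [b1 [w1 L1]]] := linked_zero_u vx.
suff [y L2 ty] : exists2 y, linked (a1, b1, w1, w1) y & triangular y.
  by exists y => //; apply: linked_trans L2.
have {vx L1} vx := valid_linked vx L1; move: a1 b1 w1 vx => {}a {}b {}w {r} vx.
have [n] : exists n : nat, (absz w <= n)%N by exists (absz w).
elim: n a b w vx => [|n IH] a b w vx Hn; have [H1 [k Hk] H3] := vx.
  exists (a, b, w, w); first exact: LinkedRefl.
  have w0 : w = 0 by lia.
  by rewrite w0 /=; lia.
have [tx|ntx] := boolP (triangular (a, b, w, w)).
  by exists (a, b, w, w) => //; exact: LinkedRefl.
have [Hw|Hw] := lerP 0 w.
  have [|y L ty] := IH _ _ _ (valid_shear vx); first by move: ntx => /=; lia.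
  by exists y => //; apply: linked_trans L; exact/linked_adjacent/AdjShear.
have vx' : valid (unshear (a, b, w, w)).
  exact/valid_mirror/valid_shear/valid_mirror.
have [|y L ty] := IH _ _ _ vx'; first by move: ntx => /=; lia.
by exists y => //; apply: linked_trans L; exact/linked_adjacent/AdjUnshear.
Qed.

(** * The lattice spanned by a basis and uniqueness of the triangular one *)

Definition in_lattice (x : state) (X Y : int) := let: (a, b, w, r) := x in
  exists i j, X = i * (a + b) + j * (w + r) /\ Y = j * (a - b) - 2 * i * (w - r).

Lemma in_lattice_adjacent x y X Y :
  adjacent x y -> in_lattice y X Y -> in_lattice x X Y.
Proof.
case: x => [[[a b] w] r] [] /=.
- by case=> i [j [-> ->]]; exists (i - 2 * j), j; split; ring.
- by case=> i [j [-> ->]]; exists (i + 2 * j), j; split; ring.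
- rewrite /unsign; case: ifP => _ [i [j [-> ->]]].
    by exists (i + j), (- 2 * i - j); split; ring.
  by exists (- (i + j)), (2 * i + j); split; ring.
- rewrite /unturn /= /unsign; case: ifP => _ [i [j [-> ->]]].
    by exists (i - j), (2 * i - j); split; ring.
  by exists (j - i), (j - 2 * i); split; ring.
Qed.

Lemma in_lattice_linked x y X Y :
  linked x y -> in_lattice y X Y -> in_lattice x X Y.
Proof. by elim=> // {}y z _ IH /in_lattice_adjacent yz /yz. Qed.

Lemma mulz_antisym (s t i j : int) :
  0 < s -> 0 < t -> t = i * s -> s = j * t -> s = t.
Proof.
move=> s0 t0 ti sj; have i0 : 0 < i by rewrite -(pmulr_lgt0 _ s0) -ti.
have j0 : 0 < j by rewrite -(pmulr_lgt0 _ t0) -sj.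
by nia.
Qed.

Lemma qform_diag a b w : qform (a, b, w, w) = (a + b) * (a - b).
Proof. by rewrite /=; ring. Qed.

(** Linked bases span the same lattice. Its points on the first axis determine [s], the determinant
    then gives [h], and [v] is determined modulo [s]. Two admissible values of [v] differ by less
    than [2s] and by an even number, hence not by the odd number [s]. *)
Lemma triangular_unique x y :
  valid x -> linked x y -> triangular x -> triangular y -> x = y.
Proof.
move=> vx xy; have yx := linked_sym vx xy; have vy := valid_linked vx xy.
have := qform_linked xy; move: vx vy xy yx.
case: x => [[[a b] w] r]; case: y => [[[a' b'] w'] r'].
move=> [s0 [k Hk] q0] [s0' _ q0'] xy yx qE.
move=> /and3P[/eqP ? w1 w2] /and3P[/eqP ? w1' w2']; subst r r'.
rewrite !qform_diag !(pmulr_rgt0 _ s0, pmulr_rgt0 _ s0') in q0 q0' qE.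
have [i [j []]] : in_lattice (a, b, w, w) (a' + b') 0.
  by apply: in_lattice_linked xy _; exists 1, 0; split; ring.
have [i' [j' []]] : in_lattice (a', b', w', w') (a + b) 0.
  by apply: in_lattice_linked yx _; exists 1, 0; split; ring.
rewrite !subrr !mulr0 !subr0.
move=> E1 /esym/eqP; rewrite mulf_eq0 [X in _ || X]gt_eqF // orbF => /eqP j0.
move=> E2 /esym/eqP; rewrite mulf_eq0 [X in _ || X]gt_eqF // orbF => /eqP j0'.
rewrite {}j0 mul0r addr0 in E1; rewrite {}j0' mul0r addr0 in E2.
have sE := mulz_antisym s0 s0' E2 E1.
have hE : a - b = a' - b'.
  by apply: (mulfI (lt0r_neq0 s0)); rewrite {2}sE.
have [i2 [j2 []]] : in_lattice (a, b, w, w) (2 * w') (a' - b').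
  by apply: in_lattice_linked xy _; exists 0, 1; split; ring.
rewrite subrr mulr0 subr0 -hE => E3 E4.
have j2E : j2 = 1.
  by apply: (mulIf (lt0r_neq0 q0)); rewrite mul1r.
rewrite {}j2E mul1r in E3.
have i2E : i2 = 0.
  have [|[|[|[]]]] : i2 <= -2 \/ i2 = -1 \/ i2 = 0 \/ i2 = 1 \/ 2 <= i2 by lia.
  - by clear -E3 w1 w2 w1' w2' sE s0; nia.
  - by move=> i2E; subst i2; lia.
  - by [].
  - by move=> i2E; subst i2; lia.
  - by clear -E3 w1 w2 w1' w2' sE s0; nia.
by subst i2; congr (_, _, _, _); lia.
Qed.

(** * Counting in a box *)

Definition oddz (n : int) : bool := (n %% 2)%Z == 1.

Lemma oddzP n : oddz n -> oddint n.
Proof. by rewrite /oddz => /eqP n1; exists (n %/ 2)%Z; lia. Qed.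

Lemma oddzM x y : oddz (x * y) = oddz x && oddz y.
Proof.
have parity (n : int) : exists k, n = 2 * k + (oddz n : nat)%:Z.
  by exists (n %/ 2)%Z; rewrite /oddz; case: eqP; lia.
have [p xE] := parity x; have [q yE] := parity y.
have -> : x * y = 2 * (2 * p * q + p * (oddz y : nat)%:Z + q * (oddz x : nat)%:Z)
    + ((oddz x : nat)%:Z * (oddz y : nat)%:Z).
  by rewrite {1}xE {1}yE; ring.
by case: (oddz x); case: (oddz y); rewrite /oddz; lia.
Qed.

(** The counts below are finite sums over boxes built from this range, with [B] so large that no
    solution is missed when two counts are compared. *)
Definition zrange (B : nat) : seq int := [seq i%:Z - B%:Z | i <- iota 0 B.*2.+1].

Lemma mem_zrange B x : (x \in zrange B) = (- B%:Z <= x) && (x <= B%:Z).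
Proof.
apply/mapP/idP => [[i]|Hx]; first by rewrite mem_iota; lia.
by exists (absz (x + B%:Z)); [rewrite mem_iota; lia | lia].
Qed.

Lemma zrange_uniq B : uniq (zrange B).
Proof. by rewrite map_inj_uniq ?iota_uniq // => i j; lia. Qed.

Definition pairs (T U : Type) (s : seq T) (t : seq U) := [seq (x, y) | x <- s, y <- t].

Lemma mem_pairs (T U : eqType) (s : seq T) (t : seq U) x y :
  ((x, y) \in pairs s t) = (x \in s) && (y \in t).
Proof. by apply/allpairsP/andP=> [[[? ?] [? ? []]]-> -> //|[? ?]]; exists (x, y). Qed.

Lemma pairs_uniq (T U : eqType) (s : seq T) (t : seq U) :
  uniq s -> uniq t -> uniq (pairs s t).
Proof. by move=> us ut; apply: allpairs_uniq => // -[? ?] [? ?] _ _. Qed.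

Lemma sum_bij (T U : eqType) (s : seq T) (t : seq U) (P : pred T) (Q : pred U)
    (f : T -> U) (g : U -> T) (F : T -> int) (G : U -> int) :
  uniq s -> uniq t -> {subset P <= s} -> {subset Q <= t} ->
  (forall x, P x -> [/\ Q (f x), g (f x) = x & F x = G (f x)]) ->
  (forall y, Q y -> P (g y) /\ f (g y) = y) ->
  \sum_(x <- s | P x) F x = \sum_(y <- t | Q y) G y.
Proof.
move=> us ut sP tQ fP gQ; rewrite -big_filter -[RHS]big_filter.
rewrite [RHS](perm_big [seq f x | x <- [seq x <- s | P x]]) /=; last first.
  apply: uniq_perm.
  - exact: filter_uniq.
  - rewrite map_inj_in_uniq ?filter_uniq // => x y; rewrite !mem_filter.
    by move=> /andP[/fP[_ fx _] _] /andP[/fP[_ fy _] _] /(congr1 g); rewrite fx fy.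
  - move=> y; rewrite mem_filter; apply/andP/mapP => [[/gQ[Pg fg] _]|[x]].
      by exists (g y); rewrite ?mem_filter ?Pg ?sP.
    by rewrite mem_filter => /andP[/fP[Qf _ _] _] ->; rewrite Qf tQ.
by rewrite big_map !big_filter; apply: eq_bigr => x /fP[].
Qed.

(** The last bound makes the determinant [s h + 2w^2 - 2r^2] exceed [s h / 2], so that reduced bases
    of a given determinant lie in a bounded box. *)
Lemma reduced_gt0 a b w r : reduced (a, b, w, r) ->
  [/\ 0 < a - b, 0 < a + b & 4 * (r * r) < (a + b) * (a - b)].
Proof.
move=> /= /and4P[H1 H2 H3 H4].
(* The two products add up to [2 (s h - 4r^2)]. *)
have P1 : 0 < (a - b - 2 * r) * (a + b + 2 * r) by apply: mulr_gt0; lia.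
have P2 : 0 < (a - b + 2 * r) * (a + b - 2 * r) by apply: mulr_gt0; lia.
by split; [lia | lia | nia].
Qed.

Lemma sqr_le_abs (x n : int) : x * x <= n -> (- n <= x) && (x <= n).
Proof. by move=> ?; nia. Qed.

Lemma pos_le_mul (x y : int) : 0 < x -> 0 < y -> x <= x * y.
Proof. by move=> ? ?; nia. Qed.

Lemma valid_qform a b w r m :
  0 < m -> oddz m -> 0 < a + b -> qform (a, b, w, r) = m -> valid (a, b, w, r).
Proof.
move=> m0 om s0 qE; split; rewrite ?qE //.
have E : (a + b) * (a - b) = m - 2 * (w * w - r * r) by rewrite -qE /=; ring.
have : oddz ((a + b) * (a - b)) by rewrite E /oddz in om *; lia.
by rewrite oddzM => /andP[/oddzP].
Qed.

Lemma mulss_ge0 (x : int) : 0 <= x * x.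
Proof. by rewrite -expr2 sqr_ge0. Qed.

Section Box.
Variable B : nat.
Local Notation I := (zrange B).
Local Notation I2 := (pairs I I).
Local Notation I3 := (pairs I2 I).
Local Notation I4 := (pairs I3 I).

Let uI2 : uniq I2. Proof. by rewrite !pairs_uniq ?zrange_uniq. Qed.
Let uI3 : uniq I3. Proof. by rewrite !pairs_uniq ?zrange_uniq. Qed.
Let uI4 : uniq I4. Proof. by rewrite !pairs_uniq ?zrange_uniq. Qed.

Definition count_reduced m : int := \sum_(x <- I4 | (qform x == m) && reduced x) 1.
Definition count_triangular m : int :=
  \sum_(x <- I4 | (qform x == m) && triangular x) 1.

Lemma box_reduced m : 2 * m <= B%:Z ->
  {subset (fun x => (qform x == m) && reduced x) <= I4}.
Proof.
move=> mB [[[a b] w] r] /andP[/eqP qE rx]; rewrite !mem_pairs !mem_zrange.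
have [h0 s0 Hr] := reduced_gt0 rx.
have E : (a + b) * (a - b) = m - 2 * (w * w) + 2 * (r * r) by rewrite -qE /=; ring.
have := sqr_le_abs (lexx (w * w)); have := sqr_le_abs (lexx (r * r)).
have := pos_le_mul s0 h0; have := pos_le_mul h0 s0; rewrite [_ * (a + b)]mulrC.
have : 0 <= w * w by nia.
have : 0 <= r * r by nia.
by lia.
Qed.

Lemma box_triangular m : 0 < m -> 2 * m <= B%:Z ->
  {subset (fun x => (qform x == m) && triangular x) <= I4}.
Proof.
move=> m0 mB [[[a b] w] r] /andP[/eqP qE /and3P[/eqP wr Hw Hw']]; subst r.
rewrite !mem_pairs !mem_zrange; rewrite qform_diag in qE.
have s0 : 0 < a + b by lia.
have h0 : 0 < a - b by rewrite -(pmulr_rgt0 _ s0) qE.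
have := pos_le_mul s0 h0; have := pos_le_mul h0 s0; rewrite [_ * (a + b)]mulrC qE.
by lia.
Qed.

(** Both sides count the classes of linked bases of determinant [m]: each class has exactly one
    reduced and exactly one triangular member. *)
Lemma count_reducedE m : 0 < m -> oddz m -> 2 * m <= B%:Z ->
  count_reduced m = count_triangular m.
Proof.
move=> m0 om mB.
have vR x : (qform x == m) && reduced x -> valid x.
  case: x => [[[a b] w] r] /andP[/eqP qE /reduced_gt0[_ s0 _]].
  exact: valid_qform qE.
have vT x : (qform x == m) && triangular x -> valid x.
  case: x => [[[a b] w] r] /andP[/eqP qE /and3P[_ H1 H2]].
  by apply: valid_qform qE => //; lia.
have /choice[f fP] x : exists y, (qform x == m) && reduced x ->
    [/\ linked x y, qform y == m & triangular y].
  have [Px|nPx] := boolP ((qform x == m) && reduced x); last by exists x.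
  have [y xy ty] := linked_triangular (vR _ Px); exists y => _; split=> //.
  by rewrite (qform_linked xy); case/andP: Px.
have /choice[g gP] x : exists y, (qform x == m) && triangular x ->
    [/\ linked x y, qform y == m & reduced y].
  have [Px|nPx] := boolP ((qform x == m) && triangular x); last by exists x.
  have [y xy ty] := triangular_reduced (vT _ Px) (proj2 (andP Px)).
  by exists y => _; split=> //; rewrite (qform_linked xy); case/andP: Px.
apply: (@sum_bij _ _ _ _ _ _ f g) => //.
- exact: box_reduced.
- exact: box_triangular.
- move=> x Px; have [xy qy ty] := fP x Px.
  have Py : (qform (f x) == m) && triangular (f x) by rewrite qy.
  have [yz qz rz] := gP _ Py; split=> //; apply/esym.
  apply: reduced_unique (vR _ Px) _ (proj2 (andP Px)) rz.
  exact: linked_trans yz.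
- move=> y Py; have [xy qy ty] := gP y Py.
  have Px : (qform (g y) == m) && reduced (g y) by rewrite qy.
  have [yz qz rz] := fP _ Px; split=> //; apply/esym.
  apply: triangular_unique (vT _ Py) _ (proj2 (andP Py)) rz.
  exact: linked_trans yz.
Qed.

Definition sigma m : int :=
  \sum_(x <- I2 | [&& 0 < x.1, 0 < x.2 & x.1 * x.2 == m]) x.1.

Lemma count_small (s : int) : 0 < s -> oddz s -> s <= B%:Z ->
  \sum_(w <- I | (2 * w < s) && (- (2 * w) < s)) 1 = s :> int.
Proof.
move=> s0 os sB; set k := absz (s %/ 2)%Z.
have sE : s = (2 * k%:Z + 1)%R by rewrite /oddz /k in os *; lia.
transitivity (\sum_(w <- zrange k | w \in zrange k) 1 : int).
  apply: (@sum_bij _ _ _ _ _ _ id id); rewrite ?zrange_uniq //.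
  - by move=> w; rewrite mem_zrange /in_mem /= => ?; lia.
  - by move=> w; rewrite mem_zrange => ?; split=> //; lia.
  - by move=> w; rewrite mem_zrange; lia.
rewrite -big_seq big_const_seq count_predT size_map size_iota iter_addr_0.
by rewrite -/(_%:R) natz sE; lia.
Qed.

(** Each factorization [m = s h] leaves [s] choices for [w]. *)
Lemma count_triangularE m : 0 < m -> oddz m -> 2 * m <= B%:Z ->
  count_triangular m = sigma m.
Proof.
move=> m0 om mB.
transitivity (\sum_(x <- I3 | [&& 0 < x.1.1, 0 < x.1.2, x.1.1 * x.1.2 == m,
     2 * x.2 < x.1.1 & - (2 * x.2) < x.1.1]) 1 : int).
  apply: (@sum_bij _ _ _ _ _ _ (fun x => (x.1.1.1 + x.1.1.2, x.1.1.1 - x.1.1.2, x.2))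
     (fun y => (((y.1.1 + y.1.2) %/ 2)%Z, ((y.1.1 - y.1.2) %/ 2)%Z, y.2, y.2))) => //.
  - exact: box_triangular.
  - move=> [[s h] w] /and5P[/= s0 h0 /eqP sh w1 w2]; rewrite !mem_pairs !mem_zrange.
    have := pos_le_mul s0 h0; have := pos_le_mul h0 s0; rewrite [h * s]mulrC sh.
    by lia.
  - move=> [[[a b] w] r] /andP[/eqP qE /and3P[/eqP wr Hw Hw']]; subst r.
    rewrite qform_diag in qE => /=; have s0 : 0 < a + b by lia.
    have h0 : 0 < a - b by rewrite -(pmulr_rgt0 _ s0) qE.
    split=> //; last by congr (_, _, _, _); lia.
    by rewrite s0 h0 qE eqxx Hw Hw'.
  - move=> [[s h] w] /and5P[/= s0 h0 /eqP sh w1 w2].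
    have /andP[os oh] : oddz s && oddz h by rewrite -oddzM sh.
    have E1 : ((s + h) %/ 2)%Z + ((s - h) %/ 2)%Z = s by rewrite /oddz in os oh; lia.
    have E2 : ((s + h) %/ 2)%Z - ((s - h) %/ 2)%Z = h by rewrite /oddz in os oh; lia.
    split; last by rewrite /= E1 E2.
    change ((qform (((s + h) %/ 2)%Z, ((s - h) %/ 2)%Z, w, w) == m)
      && triangular (((s + h) %/ 2)%Z, ((s - h) %/ 2)%Z, w, w)).
    move: E1 E2; move: ((s + h) %/ 2)%Z ((s - h) %/ 2)%Z => a b E1 E2.
    by rewrite qform_diag E1 E2 sh eqxx /= E1 eqxx w1 w2.
rewrite big_mkcond big_allpairs /sigma [RHS]big_mkcond; apply: eq_big_seq => -[s h] /=.
rewrite mem_pairs !mem_zrange => /andP[sB hB].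
case: ifP => [/and3P[s0 h0 /eqP sh]|nP].
  rewrite -[RHS]count_small //; last first.
  - by have := pos_le_mul s0 h0; lia.
  - by move: om; rewrite -sh oddzM => /andP[].
  by rewrite [RHS]big_mkcond; apply: eq_bigr => w _; rewrite s0 h0 sh eqxx.
apply: big1 => w _; case: ifP => // /and5P[s0 h0 sh _ _].
by rewrite s0 h0 sh in nP.
Qed.

(** * Sums of four odd squares *)

Section Zagier.
Variable M : int.
Hypothesis MB : M <= B%:Z.

Definition zag (x : int * (int * int)) : bool := let: (w, (d, e)) := x in
  [&& oddz w, oddz d, oddz e, 0 < d, 0 < e & w * w + 4 * (d * e) == M].
(** The image of [zag] under [(w, d, e) -> (w + 2d, d, e - w - d)]; the condition [e > 0] turns into
    [e + w - d > 0]. *)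
Definition zag' (x : int * (int * int)) : bool := let: (w, (d, e)) := x in
  [&& oddz w, oddz d, oddz e, 0 < d, 0 < e + w - d & w * w + 4 * (d * e) == M].
Local Notation J := (pairs I I2).

Let uJ : uniq J. Proof. by rewrite !pairs_uniq ?zrange_uniq. Qed.

Lemma box_zag : {subset zag <= J}.
Proof.
move=> [w [d e]] /and5P[_ _ _ d0 /andP[e0 /eqP E]]; rewrite !mem_pairs !mem_zrange.
have := sqr_le_abs (lexx (w * w)); have : 0 <= w * w by rewrite -expr2 sqr_ge0.
have := pos_le_mul d0 e0; have := pos_le_mul e0 d0; rewrite [e * d]mulrC.
by lia.
Qed.

(** For [e <= 0] the equation reads [(w - d + e) (w + d - e) = M - (d + e)^2] with both factors
    positive, which bounds all unknowns. *)
Lemma box_zag' : {subset zag' <= J}.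
Proof.
move=> [w [d e]] Pz; have [e0|e0] := ltrP 0 e.
  apply: box_zag; move: Pz => /and5P[ow od oe d0 /andP[_ E]].
  by rewrite /in_mem /= ow od oe d0 e0 E.
move: Pz => /and5P[ow od oe d0 /andP[h /eqP E]].
have s0 : 0 < w - d + e by lia.
have t0 : 0 < w + d - e by lia.
have Est : (w - d + e) * (w + d - e) = M - (d + e) * (d + e) by rewrite -E; ring.
have : 0 <= (d + e) * (d + e) by rewrite -expr2 sqr_ge0.
have := pos_le_mul s0 t0; have := pos_le_mul t0 s0.
rewrite [_ * (w - d + e)]mulrC Est !mem_pairs !mem_zrange.
by lia.
Qed.

Lemma zag_inv (f : int * (int * int) -> int * (int * int)) (F : _ -> int) :
  (forall x, zag x -> zag (f x) /\ f (f x) = x) ->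
  \sum_(x <- J | zag x) F x = \sum_(x <- J | zag x) F (f x).
Proof.
move=> fP; apply: (@sum_bij _ _ _ _ _ _ f f) => //; try exact: box_zag.
by move=> x /fP[-> /[dup] ffx ->].
Qed.

Let S1 : int := \sum_(x <- J | zag x) x.2.1 * (x.1 * x.1).
Let S2 : int := \sum_(x <- J | zag x) x.2.1 * (x.2.1 * x.2.2).

Lemma zag_sym : \sum_(x <- J | zag x) x.2.2 * (x.1 * x.1) = S1.
Proof.
rewrite (@zag_inv (fun x => (x.1, (x.2.2, x.2.1)))) // => -[w [d e]] /=.
by move=> /and5P[-> -> -> -> /andP[-> /eqP <-]]; split=> //=; apply/eqP; ring.
Qed.

(** The involution [(w, d, e) -> (w, -e, -d)] preserves this region and negates the summand. *)
Lemma zag'_neg :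
  \sum_(x <- J | zag' x && ~~ (0 < x.2.2)) (x.2.1 + x.2.2) * (x.1 * x.1) = 0.
Proof.
set S := LHS; suff : S = - S by lia.
rewrite -sumrN; apply: (@sum_bij _ _ _ _ _ _ (fun x => (x.1, (- x.2.2, - x.2.1)))
  (fun x => (x.1, (- x.2.2, - x.2.1)))) => //.
- by move=> x /andP[/box_zag'].
- by move=> x /andP[/box_zag'].
- move=> [w [d e]] /andP[/and5P[ow od oe d0 /andP[h /eqP E]] /= e0].
  split; [ | by rewrite !opprK | by ring].
  rewrite /oddz in ow od oe *; apply/andP; split; last lia.
  by apply/and5P; split; try lia; apply/andP; split; try lia; rewrite -E; apply/eqP; ring.
- move=> [w [d e]] /andP[/and5P[ow od oe d0 /andP[h /eqP E]] /= e0].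
  split; [ | by rewrite !opprK].
  rewrite /oddz in ow od oe *; apply/andP; split; last lia.
  by apply/and5P; split; try lia; apply/andP; split; try lia; rewrite -E; apply/eqP; ring.
Qed.

(** Over all of [zag] this summand gives [2 S1]. The odd number [e + w - d] changes sign under
    [(w, d, e) -> (-w, e, d)], so its positive and negative parts contribute equally. *)
Lemma zag'_pos :
  \sum_(x <- J | zag' x && (0 < x.2.2)) (x.2.1 + x.2.2) * (x.1 * x.1) = S1.
Proof.
pose F (x : int * (int * int)) := (x.2.1 + x.2.2) * (x.1 * x.1).
have E1 : \sum_(x <- J | zag x) F x = S1 + S1.
  rewrite -{2}zag_sym -big_split /=; apply: eq_bigr => x _; rewrite /F; ring.
rewrite (bigID (fun x => 0 < x.2.2 + x.1 - x.2.1)) /= in E1.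
set T := LHS; suff [E2 E3] : \sum_(x <- J | zag x && (0 < x.2.2 + x.1 - x.2.1)) F x = T /\
    \sum_(x <- J | zag x && ~~ (0 < x.2.2 + x.1 - x.2.1)) F x = T.
  by move: E1; rewrite E2 E3; lia.
split.
  apply: eq_bigl => -[w [d e]] /=.
  by case: (0 < e); case: (0 < e + w - d); rewrite ?andbT ?andbF.
apply: (@sum_bij _ _ _ _ _ _ (fun x => (- x.1, (x.2.2, x.2.1)))
  (fun x => (- x.1, (x.2.2, x.2.1)))) => //.
- by move=> x /andP[/box_zag].
- by move=> x /andP[/box_zag'].
- move=> [w [d e]] /andP[/and5P[ow od oe d0 /andP[h /eqP E]] /= e0].
  split; [ | by rewrite !opprK | by rewrite /F /=; ring].
  rewrite /oddz in ow od oe *; apply/andP; split; last lia.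
  by apply/and5P; split; try lia; apply/andP; split; try lia; rewrite -E; apply/eqP; ring.
- move=> [w [d e]] /andP[/and5P[ow od oe d0 /andP[h /eqP E]] /= e0].
  split; [ | by rewrite !opprK].
  rewrite /oddz in ow od oe *; apply/andP; split; last lia.
  by apply/and5P; split; try lia; apply/andP; split; try lia; rewrite -E; apply/eqP; ring.
Qed.

(** The substitution turns the sum of [G] over [zag] into the sum over [zag'], which is [S1]. Adding
    the same sum with [w] negated cancels the odd powers of [w] and gives
    [2 S1 = 2 S1 + 8 S2 - 8 S1]. *)
Lemma zag_sum : S1 = S2.
Proof.
pose G (x : int * (int * int)) := (x.2.2 - x.1) * (x.1 + 2 * x.2.1) * (x.1 + 2 * x.2.1).
have E1 : \sum_(x <- J | zag x) G x = S1.
  transitivity (\sum_(x <- J | zag' x) (x.2.1 + x.2.2) * (x.1 * x.1)); last first.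
    by rewrite (bigID (fun x => 0 < x.2.2)) /= zag'_pos zag'_neg addr0.
  apply: (@sum_bij _ _ _ _ _ _ (fun x => (x.1 + 2 * x.2.1, (x.2.1, x.2.2 - x.1 - x.2.1)))
    (fun x => (x.1 - 2 * x.2.1, (x.2.1, x.2.2 + x.1 - x.2.1)))) => //.
  - exact: box_zag.
  - exact: box_zag'.
  - move=> [w [d e]] /and5P[ow od oe d0 /andP[h /eqP E]] /=.
    split; [ | by congr (_, (_, _)); ring | by rewrite /G /=; ring].
    rewrite /oddz in ow od oe *.
    by apply/and5P; split; try lia; apply/andP; split; try lia; rewrite -E; apply/eqP; ring.
  - move=> [w [d e]] /and5P[ow od oe d0 /andP[h /eqP E]] /=.
    split; [ | by congr (_, (_, _)); ring].
    rewrite /oddz in ow od oe *.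
    by apply/and5P; split; try lia; apply/andP; split; try lia; rewrite -E; apply/eqP; ring.
have E2 : \sum_(x <- J | zag x) G x = \sum_(x <- J | zag x) G (- x.1, x.2).
  apply: zag_inv => -[w [d e]] /and5P[ow od oe d0 /andP[h /eqP E]] /=.
  split; [ | by rewrite opprK].
  rewrite /oddz in ow od oe *.
  by apply/and5P; split; try lia; apply/andP; split; try lia; rewrite -E; apply/eqP; ring.
have E3 : \sum_(x <- J | zag x) G x + \sum_(x <- J | zag x) G (- x.1, x.2)
    = S1 * 2 + S2 * 8 - S1 * 8.
  transitivity (\sum_(x <- J | zag x) (x.2.2 * (x.1 * x.1) * 2
      + x.2.1 * (x.2.1 * x.2.2) * 8 - x.2.1 * (x.1 * x.1) * 8)).
    by rewrite -big_split /=; apply: eq_bigr => x _; rewrite /G /=; ring.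
  by rewrite sumrB big_split -!big_distrl /= zag_sym.
by rewrite -E2 E1 in E3; lia.
Qed.
End Zagier.

(** * Two functions with the same recurrence *)

Definition odd_squares (x : state) n : bool := let: (a, b, c, d) := x in
  [&& oddz a, oddz b, oddz c, oddz d & a * a + b * b + c * c + d * d == n].
Definition count_odd n : int := \sum_(x <- I4 | odd_squares x n) 1.
Definition odd_sigma n : int :=
  \sum_(x <- I2 | [&& oddz x.1, oddz x.2, 0 < x.1, 0 < x.2 & 4 * (x.1 * x.2) == n]) x.1.

(** Where [M - w^2 = 4de], the factor [M - 5w^2] equals [4 (de - w^2)], so the sum is four times the
    difference of the two sides of [zag_sum]. *)
Lemma odd_sigma_rec M : M <= B%:Z ->
  \sum_(w <- I | oddz w) (M - 5 * (w * w)) * odd_sigma (M - w * w) = 0.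
Proof.
move=> MB; have := zag_sum MB => /eqP; rewrite -subr_eq0 => /eqP E.
transitivity (\sum_(x <- pairs I I2 | zag M x) (4 * (x.2.1 * (x.2.1 * x.2.2)
    - x.2.1 * (x.1 * x.1)))); last first.
  by rewrite -big_distrr /= sumrB -[X in _ * X]opprB E oppr0 mulr0.
rewrite [RHS]big_mkcond big_allpairs [LHS]big_mkcond; apply: eq_bigr => w _ /=.
case: ifP => [ow|now]; last first.
  by rewrite big1 // => -[d e] _.
rewrite /odd_sigma big_distrr /= -big_mkcond; apply: eq_big => [[d e]|[d e] /=].
  by rewrite /=; congr [&& _, _, _, _ & _]; apply/eqP/eqP; lia.
by move=> /and5P[_ _ _ _ /eqP E']; have -> : M = w * w + 4 * (d * e); [lia | ring].
Qed.

Lemma box_odd_squares n : n <= B%:Z -> {subset odd_squares^~ n <= I4}.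
Proof.
move=> nB [[[a b] c] d] /and5P[_ _ _ _ /eqP E]; rewrite !mem_pairs !mem_zrange.
have := sqr_le_abs (lexx (a * a)); have := sqr_le_abs (lexx (b * b)).
have := sqr_le_abs (lexx (c * c)); have := sqr_le_abs (lexx (d * d)).
have sq (x : int) : 0 <= x * x by rewrite -expr2 sqr_ge0.
have := sq a; have := sq b; have := sq c; have := sq d.
by lia.
Qed.

(** On solutions of [w^2 + a^2 + b^2 + c^2 + d^2 = M] the factor is [a^2 + b^2 + c^2 + d^2 - 4w^2],
    and exchanging [w] with another coordinate shows that all five squares have the same total. *)
Lemma count_odd_rec M : M <= B%:Z ->
  \sum_(w <- I | oddz w) (M - 5 * (w * w)) * count_odd (M - w * w) = 0.
Proof.
move=> MB; pose P (x : int * state) := oddz x.1 && odd_squares x.2 (M - x.1 * x.1).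
have boxP : {subset P <= pairs I I4}.
  move=> [w x] /andP[_ Px]; rewrite mem_pairs (box_odd_squares _ Px).
    rewrite andbT mem_zrange; have := sqr_le_abs (lexx (w * w)).
    move: x Px => [[[a b] c] d] /and5P[_ _ _ _ /eqP /= E].
    have sq (x : int) : 0 <= x * x by rewrite -expr2 sqr_ge0.
    by have := sq a; have := sq b; have := sq c; have := sq d; lia.
  have : 0 <= w * w by rewrite -expr2 sqr_ge0.
  by rewrite /=; lia.
have uP : uniq (pairs I I4) by rewrite !pairs_uniq ?zrange_uniq.
pose S (F : int * state -> int) := \sum_(x <- pairs I I4 | P x) F x.
have SE (f : int * state -> int * state) F G :
    (forall x, P x -> P (f x)) -> involutive f -> (forall x, G x = F (f x)) -> S G = S F.
  move=> fP fK FG; apply: (@sum_bij _ _ _ _ _ _ f f) => //.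
  - by move=> x /fP Pf; split.
  - by move=> x /fP Pf; split.
have Sa : S (fun x => x.2.1.1.1 * x.2.1.1.1) = S (fun x => x.1 * x.1).
  apply: (SE (fun x => let: (w, (a, b, c, d)) := x in (a, (w, b, c, d)))).
  - move=> [w [[[a b] c] d]] /andP[/= ow /and5P[oa ob oc od /eqP E]].
    by rewrite /P /= ow oa ob oc od /=; apply/eqP; lia.
  - by move=> [w [[[a b] c] d]].
  - by move=> [w [[[a b] c] d]].
have Sb : S (fun x => x.2.1.1.2 * x.2.1.1.2) = S (fun x => x.1 * x.1).
  apply: (SE (fun x => let: (w, (a, b, c, d)) := x in (b, (a, w, c, d)))).
  - move=> [w [[[a b] c] d]] /andP[/= ow /and5P[oa ob oc od /eqP E]].
    by rewrite /P /= ow oa ob oc od /=; apply/eqP; lia.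
  - by move=> [w [[[a b] c] d]].
  - by move=> [w [[[a b] c] d]].
have Sc : S (fun x => x.2.1.2 * x.2.1.2) = S (fun x => x.1 * x.1).
  apply: (SE (fun x => let: (w, (a, b, c, d)) := x in (c, (a, b, w, d)))).
  - move=> [w [[[a b] c] d]] /andP[/= ow /and5P[oa ob oc od /eqP E]].
    by rewrite /P /= ow oa ob oc od /=; apply/eqP; lia.
  - by move=> [w [[[a b] c] d]].
  - by move=> [w [[[a b] c] d]].
have Sd : S (fun x => x.2.2 * x.2.2) = S (fun x => x.1 * x.1).
  apply: (SE (fun x => let: (w, (a, b, c, d)) := x in (d, (a, b, c, w)))).
  - move=> [w [[[a b] c] d]] /andP[/= ow /and5P[oa ob oc od /eqP E]].
    by rewrite /P /= ow oa ob oc od /=; apply/eqP; lia.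
  - by move=> [w [[[a b] c] d]].
  - by move=> [w [[[a b] c] d]].
transitivity (S (fun x => M - 5 * (x.1 * x.1))).
  rewrite /S big_mkcond [RHS]big_mkcond big_allpairs; apply: eq_bigr => w _ /=.
  rewrite /P /=; case: ifP => [ow|now]; last by rewrite big1.
  by rewrite /count_odd big_distrr /= -big_mkcond; apply: eq_bigr => x _; rewrite mulr1.
have -> : S (fun x => M - 5 * (x.1 * x.1)) = S (fun x => x.2.1.1.1 * x.2.1.1.1
    + x.2.1.1.2 * x.2.1.1.2 + x.2.1.2 * x.2.1.2 + x.2.2 * x.2.2 - 4 * (x.1 * x.1)).
  by apply: eq_bigr => -[w [[[a b] c] d]] /andP[_ /and5P[_ _ _ _ /eqP /= E]]; lia.
rewrite /S sumrB !big_split /= -/(S _) -/(S _) -/(S _) -/(S _) Sa Sb Sc Sd.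
by rewrite -big_distrr /= -/(S _); ring.
Qed.

Lemma odd_sqr_gt0 (x : int) : oddz x -> 1 <= x * x.
Proof. by rewrite /oddz => ox; nia. Qed.

Lemma count_odd_le0 n : n <= 0 -> count_odd n = 0.
Proof.
move=> n0; apply: big1 => -[[[a b] c] d] /and5P[/odd_sqr_gt0 oa _ _ _ /eqP E].
by have := mulss_ge0 b; have := mulss_ge0 c; have := mulss_ge0 d; lia.
Qed.

Lemma odd_sigma_le0 n : n <= 0 -> odd_sigma n = 0.
Proof.
move=> n0; apply: big1 => -[d e] /= /and5P[_ _ d0 e0 /eqP E].
by have := mulr_gt0 d0 e0; lia.
Qed.

Lemma count_odd4 : 4 <= B%:Z -> count_odd 4 = 16.
Proof.
move=> B4; pose L : seq int := [:: 1; -1].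
transitivity (\sum_(x <- pairs (pairs (pairs L L) L) L | odd_squares x 4) 1 : int).
  apply: (@sum_bij _ _ _ _ _ _ id id) => //.
  - exact: box_odd_squares.
  - move=> [[[a b] c] d] /and5P[oa ob oc od /eqP E].
    have mL (x : int) : oddz x -> x * x <= 1 -> x \in L.
      by rewrite /oddz !inE => *; nia.
    have := (odd_sqr_gt0 oa, odd_sqr_gt0 ob, odd_sqr_gt0 oc, odd_sqr_gt0 od).
    by move=> [[[? ?] ?] ?]; rewrite !mem_pairs !mL //; lia.
by rewrite unlock.
Qed.

Lemma odd_sigma4 : 4 <= B%:Z -> odd_sigma 4 = 1.
Proof.
move=> B4; transitivity (\sum_(x <- [:: (1 : int, 1 : int)] | x == (1, 1)) x.1); last first.
  by rewrite unlock.
apply: (@sum_bij _ _ _ _ _ _ id id) => //.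
- move=> [d e] /and5P[/= _ _ d0 e0 /eqP E]; rewrite mem_pairs !mem_zrange.
  by have := pos_le_mul d0 e0; have := pos_le_mul e0 d0; rewrite [e * d]mulrC; lia.
- by move=> x; rewrite inE.
- move=> [d e] /and5P[/= _ _ d0 e0 /eqP E]; split=> //.
  have := pos_le_mul d0 e0; have := pos_le_mul e0 d0; rewrite [e * d]mulrC => *.
  by apply/eqP; congr (_, _); lia.
- by move=> _ /eqP->.
Qed.

Lemma sum_pm1 (g : int -> int) : 1 <= B%:Z -> (forall w, oddz w -> 1 < w * w -> g w = 0) ->
  \sum_(w <- I | oddz w) g w = g 1 + g (-1).
Proof.
move=> B1 g0; rewrite (bigID (fun w => w * w == 1)) /= [X in _ + X]big1 ?addr0; last first.
  by move=> w /andP[ow w1]; apply: g0 => //; have := odd_sqr_gt0 ow; lia.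
transitivity (\sum_(w <- [:: 1 : int; -1] | w * w == 1) g w); last first.
  by rewrite !big_cons big_nil addr0.
apply: (@sum_bij _ _ _ _ _ _ id id) => //; first exact: zrange_uniq.
- by move=> w /andP[_ /eqP w1]; rewrite mem_zrange; have := @sqr_le_abs w 1; lia.
- by move=> w /eqP w1; rewrite !inE; nia.
- by move=> w /andP[].
- by move=> w /[dup] w1 ->; rewrite andbT; split=> //; rewrite /oddz; move/eqP in w1; nia.
Qed.

(** By induction, the recurrence at [M = 4K + 1] for the difference [e] keeps only the terms [w = 1]
    and [w = -1], which leaves [2 (M - 5) e(4K) = 0]. *)
Lemma count_oddE K : 0 < K -> oddz K -> 4 * K + 1 <= B%:Z ->
  count_odd (4 * K) = 16 * odd_sigma (4 * K).
Proof.
have [n] : exists n : nat, K <= n%:Z by exists (absz K); lia.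
elim: n K => [|n IH] K Kn K0 oK KB; first lia.
(* For [K = 1] the coefficient [M - 5] is zero, so this case is computed directly. *)
have [->|K1] := eqVneq K 1; first by rewrite count_odd4 ?odd_sigma4; lia.
pose M := 4 * K + 1; pose e n := count_odd n - 16 * odd_sigma n.
have : \sum_(w <- I | oddz w) (M - 5 * (w * w)) * e (M - w * w) = 0.
  transitivity (\sum_(w <- I | oddz w) (M - 5 * (w * w)) * count_odd (M - w * w)
    - 16 * \sum_(w <- I | oddz w) (M - 5 * (w * w)) * odd_sigma (M - w * w)).
    by rewrite big_distrr /= -sumrB; apply: eq_bigr => w _; rewrite /e; ring.
  by rewrite count_odd_rec // odd_sigma_rec // mulr0 subr0.
rewrite sum_pm1; first last.
- move=> w /oddzP[k wE] w1; apply/eqP; rewrite mulf_eq0; apply/orP; right; apply/eqP.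
  (* With [w = 2k + 1] other than 1 and -1, [k (k + 1)] is positive and even, so [K'] is smaller
     than [K] and still odd. *)
  pose K' := K - k * (k + 1).
  have E : M - w * w = 4 * K' by rewrite /M /K' wE; ring.
  have k2 : oddz (k * (k + 1)) = false by rewrite oddzM /oddz; lia.
  have k0 : 0 < k * (k + 1) by rewrite wE in w1; nia.
  rewrite E /e; have [K'0|K'0] := lerP K' 0.
    by rewrite count_odd_le0 ?odd_sigma_le0 ?mulr0 ?subr0 //; lia.
  by rewrite IH ?subrr //; rewrite /K' ?/oddz in k2 oK *; lia.
- lia.

rewrite mulrNN (_ : M - 1 * 1 = 4 * K); last by rewrite /M; ring.
rewrite -mulrDl => /eqP; rewrite mulf_eq0 => /orP[/eqP|/eqP]; last by rewrite /e; lia.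
by rewrite /M; lia.
Qed.

Lemma odd_sigmaE m : oddz m -> odd_sigma (4 * m) = sigma m.
Proof.
move=> om; apply: eq_bigl => -[d e] /=.
apply/and5P/and3P => [[_ _ -> -> /eqP E]|[-> -> /eqP E]]; first by split=> //; lia.
by move: om; rewrite -E oddzM => /andP[-> ->]; split.
Qed.

(** * The ternary form [a^2 + b^2 + 2 z^2] *)

Lemma sum_split2 (T : eqType) (s : seq T) (P Q : pred T) (f : T -> T) :
  uniq s -> {subset P <= s} -> involutive f ->
  (forall x, P x -> P (f x) /\ Q (f x) = ~~ Q x) ->
  \sum_(x <- s | P x) 1 = 2 * \sum_(x <- s | P x && Q x) 1 :> int.
Proof.
move=> us sP fK fP; rewrite (bigID Q) /= mulr_natl mulr2n; congr (_ + _).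
apply: (@sum_bij _ _ _ _ _ _ f f) => //.
- by move=> x /andP[/sP].
- by move=> x /andP[/sP].
- by move=> x /andP[/fP[-> ->] ->]; split.
- by move=> x /andP[/fP[-> ->] ->]; split.
Qed.

Definition count_quaternary m : int := \sum_(x <- I4 | let: (a, b, z, w) := x in
  a * a + b * b + 2 * (z * z) + 2 * (w * w) == m) 1.

(** Fixing the signs of [b] and [d] by requiring 4 to divide [a - b] and [c - d] accounts for the
    factor 4. The remaining solutions are [(p + q + 2z, p + q - 2z, p - q + 2w, p - q - 2w)] with
    [p^2 + q^2 + 2z^2 + 2w^2 = m]. *)
Lemma count_odd4E m : oddz m -> 4 * m <= B%:Z -> count_odd (4 * m) = 4 * count_quaternary m.
Proof.
move=> om mB.
rewrite /count_odd (@sum_split2 _ _ _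
  (fun x : state => ((x.1.1.1 - x.1.1.2) %% 4)%Z == 0)
  (fun x : state => (x.1.1.1, - x.1.1.2, x.1.2, x.2))) //; first last.
- move=> [[[a b] c] d] /and5P[oa ob oc od /eqP E] /=; rewrite oa oc od /=.
  rewrite /oddz in oa ob *; split; last lia.
  by apply/andP; split; [lia | rewrite -E; apply/eqP; ring].
- by move=> [[[a b] c] d] /=; rewrite opprK.
- exact: box_odd_squares.
rewrite (@sum_split2 _ _ _
  (fun x : state => ((x.1.2 - x.2) %% 4)%Z == 0)
  (fun x : state => (x.1.1.1, x.1.1.2, x.1.2, - x.2))) //; first last.
- move=> [[[a b] c] d] /andP[/and5P[oa ob oc od /eqP E] /= ->]; rewrite oa ob oc /=.
  rewrite /oddz in oc od *; split; last lia.
  by rewrite andbT; apply/andP; split; [lia | rewrite -E; apply/eqP; ring].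
- by move=> [[[a b] c] d] /=; rewrite opprK.
- by move=> x /andP[Px _]; apply: box_odd_squares Px.
rewrite mulrA; congr (_ * _).
apply: (@sum_bij _ _ _ _ _ _ (fun x => let: (a, b, c, d) := x in
    (((a + b + c + d) %/ 4)%Z, ((a + b - c - d) %/ 4)%Z, ((a - b) %/ 4)%Z, ((c - d) %/ 4)%Z))
  (fun y => let: (a, b, z, w) := y in
    (a + b + 2 * z, a + b - 2 * z, a - b + 2 * w, a - b - 2 * w))) => //.
- by move=> x /andP[/andP[Px _] _]; apply: box_odd_squares Px.
- move=> [[[a b] z] w] /eqP E; rewrite !mem_pairs !mem_zrange.
  have := sqr_le_abs (lexx (a * a)); have := sqr_le_abs (lexx (b * b)).
  have := sqr_le_abs (lexx (z * z)); have := sqr_le_abs (lexx (w * w)).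
  have := mulss_ge0 a; have := mulss_ge0 b; have := mulss_ge0 z; have := mulss_ge0 w.
  by lia.
- move=> [[[a b] c] d] /andP[/andP[/and5P[oa ob oc od /eqP E] /= ab] cd].
  have [[i ai] [j cj]] := (oddzP oa, oddzP oc).
  have Hz : a - b = 4 * ((a - b) %/ 4)%Z by clear -ab; lia.
  have Hw : c - d = 4 * ((c - d) %/ 4)%Z by clear -cd; lia.
  have Hs : a + b + c + d = 4 * ((a + b + c + d) %/ 4)%Z by clear -ai cj Hz Hw; lia.
  have Hd : a + b - c - d = 4 * ((a + b - c - d) %/ 4)%Z by clear -ai cj Hz Hw; lia.
  move: Hz Hw Hs Hd; move: ((a - b) %/ 4)%Z ((c - d) %/ 4)%Z ((a + b + c + d) %/ 4)%Z.
  move: ((a + b - c - d) %/ 4)%Z => q z w p Hz Hw Hs Hd.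
  have [? ? ? ?] : [/\ a = p + q + 2 * z, b = p + q - 2 * z, c = p - q + 2 * w
    & d = p - q - 2 * w] by clear -Hz Hw Hs Hd; split; lia.
  clear ai cj; subst a b c d; split=> //.
  have : 4 * (p * p + q * q + 2 * (z * z) + 2 * (w * w)) = 4 * m by rewrite -E; ring.
  by move=> ?; apply/eqP; lia.
- move=> [[[a b] z] w] /eqP E.
  (* This makes the four linear forms odd. *)
  have oab : oddz (a + b).
    have : oddz ((a + b) * (a + b)).
      have -> : (a + b) * (a + b) = m + 2 * (a * b - z * z - w * w) by rewrite -E; ring.
      by rewrite /oddz in om *; lia.
    by rewrite oddzM andbb.
  split; last by rewrite /oddz in oab; congr (_, _, _, _); lia.
  rewrite /oddz in oab *; apply/andP; split; last by rewrite /=; lia.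
  apply/andP; split; last by rewrite /=; lia.
  by apply/and5P; split; rewrite ?/oddz; try lia; rewrite -E; apply/eqP; ring.
Qed.

Definition count_ternary k : int := \sum_(x <- I3 | let: (a, b, z) := x in
  a * a + b * b + 2 * (z * z) == k) 1.
Definition count_cone k : int := \sum_(x <- I3 |
  (qform (x.1, 0, x.2) == k) && reduced (x.1, 0, x.2)) 1.

Lemma count_quaternary_fiber m : count_quaternary m = \sum_(w <- I) count_ternary (m - 2 * (w * w)).
Proof.
rewrite /count_quaternary big_mkcond big_allpairs exchange_big; apply: eq_bigr => w _.
rewrite /count_ternary [RHS]big_mkcond; apply: eq_bigr => -[[a b] z] _ /=.
by congr (if _ then _ else _); apply/eqP/eqP; lia.
Qed.

(** The condition [reduced] does not involve [w], so each fibre is a [count_cone]. *)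
Lemma count_reduced_fiber m :
  count_reduced m = \sum_(w <- I) count_cone (m - 2 * (w * w)).
Proof.
transitivity (\sum_(x <- I2) \sum_(w <- I) \sum_(r <- I)
  if (qform (x, w, r) == m) && reduced (x, w, r) then 1 else 0 : int).
  by rewrite /count_reduced big_mkcond !big_allpairs.
rewrite exchange_big; apply: eq_bigr => w _.
rewrite /count_cone [RHS]big_mkcond [RHS]big_allpairs /=; apply: eq_bigr => -[a b] _.
apply: eq_bigr => r _ /=; congr (if _ && _ then _ else _).
by apply/eqP/eqP; lia.
Qed.

Lemma count_ternary_le0 k : k < 0 -> count_ternary k = 0.
Proof.
move=> k0; apply: big1 => -[[a b] z] /eqP E.
by have := mulss_ge0 a; have := mulss_ge0 b; have := mulss_ge0 z; lia.
Qed.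

Lemma count_cone_le0 k : k < 0 -> count_cone k = 0.
Proof.
move=> k0; apply: big1 => -[[a b] r] /andP[/eqP E /reduced_gt0[_ _ H]].
have : (a + b) * (a - b) = k + 2 * (r * r) by rewrite -E /=; ring.
by move: H; have := mulss_ge0 r; rewrite /=; lia.
Qed.

Lemma count_ternaryE k : 0 < k -> oddz k -> 4 * k + 1 <= B%:Z -> count_ternary k = 4 * count_cone k.
Proof.
have [n] : exists n : nat, k <= n%:Z by exists (absz k); lia.
elim: n k => [|n IH] k kn k0 ok kB; first lia.
pose e n := count_ternary n - 4 * count_cone n.
have : \sum_(w <- I) e (k - 2 * (w * w)) = 0.
  (* The sums are [count_quaternary k], which is [4 sigma k], and [count_reduced k], which is
     [sigma k]. *)
  rewrite sumrB -count_quaternary_fiber -big_distrr /= -count_reduced_fiber.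
  have kB4 : 4 * k <= B%:Z by lia.
  have kB2 : 2 * k <= B%:Z by lia.
  have := count_odd4E ok kB4; rewrite (count_oddE k0 ok kB) (odd_sigmaE ok).
  rewrite -(count_triangularE k0 ok kB2) -(count_reducedE k0 ok kB2).
  by lia.
rewrite (bigD1_seq 0) ?zrange_uniq //=; last by rewrite mem_zrange; lia.
(* For [w] nonzero the term vanishes by induction, or because [k - 2w^2] is negative. *)
rewrite big1 => [|w w0].
  by rewrite !mulr0 subr0 addr0 /e; lia.
have w2 : 0 < w * w by nia.
have [k'0|k'0] := ltrP (k - 2 * (w * w)) 0.
  by rewrite /e count_ternary_le0 ?count_cone_le0 ?mulr0 ?subr0.
by rewrite /e IH ?subrr //; rewrite /oddz in ok *; lia.
Qed.

Lemma count_cone_gt0 k : 0 < k -> oddz k -> k <= B%:Z -> 0 < count_cone k.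
Proof.
(* The solution with [a + b = k], [a - b = 1] and [r = 0]. *)
move=> k0 ok kB; pose x := (((k + 1) %/ 2)%Z, ((k - 1) %/ 2)%Z, 0 : int).
rewrite /count_cone big_mkcond (bigD1_seq x) /=; first last.
- exact: uI3.
- by rewrite !mem_pairs !mem_zrange; lia.
case: ifP => [_|/negP[]].
  by apply: ltr_pwDl => //; apply: sumr_ge0 => y _; case: ifP.
have [j kE] := oddzP ok.
have -> : ((k + 1) %/ 2)%Z = j + 1 by lia.
have -> : ((k - 1) %/ 2)%Z = j by lia.
by apply/andP; split; [apply/eqP; rewrite kE; ring | lia].
Qed.
End Box.

Theorem odd_three_squares (k : int) : 0 < k -> oddz k ->
  exists a b z : int, a * a + b * b + 2 * (z * z) = k.
Proof.
move=> k0 ok; pose B := absz (4 * k + 1).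
have /negP : count_ternary B k != 0.
  by rewrite count_ternaryE ?mulf_eq0 //= ?gt_eqF // ?count_cone_gt0 // /B; lia.
apply: contra_notP => nE; apply/eqP/big1 => -[[a b] z] /eqP E.
by case: nE; exists a, b, z.
Qed.

(** * The distance graph *)

Lemma sum_mod3_neq0 (x y z d : int) : (d %% 3)%Z = 2 ->
  x * x + y * y + z * z = 2 * d -> ((x + y + z) %% 3)%Z != 0.
Proof.
move=> d2 E; have mod3 (t : int) : exists i, t = 3 * i \/ t = 3 * i + 1 \/ t = 3 * i + 2.
  by exists (t %/ 3)%Z; lia.
have [i xE] := mod3 x; have [j yE] := mod3 y; have [k zE] := mod3 z.
by case: xE => [->|[->|->]] in E *; case: yE => [->|[->|->]] in E *;
  case: zE => [->|[->|->]] in E *; lia.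
Qed.

(** * Absence of a 2-colouring *)

Section OddCycle.
Variables (x y z n : int) (b : int -> int -> int -> bool).
Hypothesis xyz : x * x + y * y + z * z = n.
Hypothesis ox : oddz x.
Hypothesis xyz2 : oddz (x + y + z) = false.
Hypothesis bP : forall p1 p2 p3 q1 q2 q3 : int,
  (p1 - q1) * (p1 - q1) + (p2 - q2) * (p2 - q2) + (p3 - q3) * (p3 - q3) = n ->
  b p1 p2 p3 != b q1 q2 q3.

Lemma step_neg p1 p2 p3 u v w : u * u + v * v + w * w = n ->
  b (p1 + u) (p2 + v) (p3 + w) = ~~ b p1 p2 p3.
Proof.
move=> E; have : b (p1 + u) (p2 + v) (p3 + w) != b p1 p2 p3 by apply: bP; rewrite -E; ring.
by case: (b _ _ _); case: (b _ _ _).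
Qed.

Lemma period_mul (f : int -> bool) t : (forall p, f (p + t) = f p) ->
  forall k p, f (p + k * t) = f p.
Proof.
move=> ft; have fN (k : nat) p : f (p + k%:Z * t) = f p.
  elim: k p => [|k IH] p; first by rewrite mul0r addr0.
  by rewrite (_ : p + _ = p + t + k%:Z * t) ?IH ?ft //; rewrite -addn1 PoszD; ring.
move=> k p; have [k0|k0] := lerP 0 k; first by rewrite -(gez0_abs k0).
rewrite -(fN (absz k) (p + k * t)); congr f.
by rewrite (_ : (absz k)%:Z = - k); [ring | lia].
Qed.

Lemma shift_axes k p1 p2 p3 :
  b (p1 + k * (2 * x)) (p2 + k * (2 * x)) (p3 + k * (2 * x)) = b p1 p2 p3.
Proof.
have X q1 q2 q3 : b (q1 + 2 * x) q2 q3 = b q1 q2 q3.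
  (* The step [(x, y, z)] from [q] and the step [(-x, y, z)] from [q + (2x, 0, 0)] end at the same
     point. *)
  apply: negb_inj; rewrite -(step_neg q1 q2 q3 xyz).
  rewrite -(step_neg (q1 + 2 * x) q2 q3 (_ : (- x) * (- x) + y * y + z * z = n)).
    by congr b; ring.
  by rewrite -xyz; ring.
have Y q1 q2 q3 : b q1 (q2 + 2 * x) q3 = b q1 q2 q3.
  apply: negb_inj.
  rewrite -(step_neg q1 q2 q3 (_ : y * y + x * x + z * z = n)); last by rewrite -xyz; ring.
  rewrite -(step_neg q1 (q2 + 2 * x) q3 (_ : y * y + (- x) * (- x) + z * z = n)).
    by congr b; ring.
  by rewrite -xyz; ring.
have Z q1 q2 q3 : b q1 q2 (q3 + 2 * x) = b q1 q2 q3.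
  apply: negb_inj.
  rewrite -(step_neg q1 q2 q3 (_ : z * z + y * y + x * x = n)); last by rewrite -xyz; ring.
  rewrite -(step_neg q1 q2 (q3 + 2 * x) (_ : z * z + y * y + (- x) * (- x) = n)).
    by congr b; ring.
  by rewrite -xyz; ring.
rewrite (period_mul (f := fun q => b q _ _)) // (period_mul (f := fun q => b _ q _)) //.
exact: (period_mul (f := fun q => b _ _ q)).
Qed.

Lemma no_two_coloring : False.
Proof.
pose s := x + y + z.
have S p1 p2 p3 : b (p1 + s) (p2 + s) (p3 + s) = ~~ b p1 p2 p3.
  (* The three steps are [(x, y, z)], [(y, z, x)] and [(z, x, y)]. *)
  have -> : p1 + s = p1 + x + y + z by rewrite /s; ring.
  have -> : p2 + s = p2 + y + z + x by rewrite /s; ring.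
  have -> : p3 + s = p3 + z + x + y by rewrite /s; ring.
  by rewrite !step_neg ?negbK //; rewrite -xyz; ring.
have Sk (k : nat) : b (k%:Z * s) (k%:Z * s) (k%:Z * s) = odd k (+) b 0 0 0.
  elim: k => [|k IH]; first by rewrite !mul0r.
  have -> : k.+1%:Z * s = k%:Z * s + s by rewrite -addn1 PoszD; ring.
  by rewrite S IH /=; case: (odd k); case: (b 0 0 0).
have [j sE] : exists j, s = 2 * j.
  by exists (s %/ 2)%Z; move: xyz2; rewrite -/s /oddz; lia.
(* As [s] is even, [|x| s] is a multiple of [2x]: the walk returns to the colour of the origin after
   an odd number of colour changes. *)
have [k kE] : exists k, (absz x)%:Z * s = k * (2 * x).
  have [x0|x0] := lerP 0 x; [exists j | exists (- j)]; rewrite sE.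
    by rewrite (gez0_abs x0); ring.
  by rewrite (_ : (absz x)%:Z = - x); [ring | lia].
have := Sk (absz x); rewrite kE -[k * _]add0r shift_axes.
have -> : odd (absz x) by move: ox; rewrite /oddz; lia.
by case: (b 0 0 0).
Qed.
End OddCycle.

Lemma edist_int (R : realType) (a b : 'rV[R]_3) (f g : 'I_3 -> int) (d : nat) :
  (forall i, a ord0 i = (f i)%:~R) -> (forall i, b ord0 i = (g i)%:~R) ->
  edist a b = Num.sqrt ((2 * d)%N%:R) <->
  \sum_(i < 3) (f i - g i) * (f i - g i) = (2 * d%:Z).
Proof.
move=> fa gb; rewrite /edist.
have -> : \sum_(i < 3) (a ord0 i - b ord0 i) ^+ 2 =
    (\sum_(i < 3) (f i - g i) * (f i - g i))%:~R.
  rewrite rmorph_sum; apply: eq_bigr => i _.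
  by rewrite fa gb expr2 rmorphM rmorphB.
have -> : (2 * d)%N%:R = (2 * d%:Z)%:~R :> R by rewrite rmorphM /= natrM.
set S := \sum_(i < 3) _.
have S0 : 0 <= S by apply: sumr_ge0 => i _; rewrite mulss_ge0.
split=> [E|->] //; apply/eqP; rewrite -(eqr_int R) -(sqr_sqrtr (_ : 0 <= S%:~R :> R)) ?ler0z //.
by rewrite E sqr_sqrtr // ler0z.
Qed.

Theorem theorem1 (R : realType) (d : nat) (d_gt0 : (0 < d)%N)
    (d_odd : odd d) (d_mod3 : d = 2 %[mod 3]) :
  is_chromatic_number
    (dist_graph (int_lattice R 3) (Num.sqrt ((2 * d)%N%:R : R))) 3.
Proof.
split.
  pose F (v : set_type (int_lattice R 3)) i : int := Num.floor (val v ord0 i).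
  have FE (v : set_type (int_lattice R 3)) i : val v ord0 i = (F v i)%:~R.
    by apply/esym/floorK; have := set_valP v; apply.
  pose c v := ((\sum_(i < 3) F v i) %% 3)%Z.
  exists (fun v => inord (absz (c v))) => a b /(edist_int _ (FE a) (FE b)) E.
  have lt3 v : (absz (c v) < 3)%N by rewrite /c; lia.
  move=> /(congr1 val); rewrite /= !inordK //.
  move: E; rewrite /c !big_ord_recl !big_ord0 !addr0 !addrA => /sum_mod3_neq0.
  by lia.
move=> m [c cP]; rewrite leqNgt; apply/negP => m3.
have dz : oddz d%:Z by rewrite /oddz; lia.
have [|x [y [z E]]] := odd_three_squares _ dz; first lia.
pose vec (p1 p2 p3 : int) (i : 'I_3) : int := nth 0 [:: p1; p2; p3] i.
have lat p1 p2 p3 : (\row_i (vec p1 p2 p3 i)%:~R) \in int_lattice R 3.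
  by apply/mem_set => i; rewrite mxE intr_int.
pose P p1 p2 p3 : set_type (int_lattice R 3) := SigSub (lat p1 p2 p3).
(* From [x^2 + y^2 + 2z^2 = d] follows [(x + y)^2 + (x - y)^2 + (2z)^2 = 2d]. *)
apply: (@no_two_coloring (x + y) (x - y) (2 * z) (2 * d%:Z)
  (fun p1 p2 p3 => val (c (P p1 p2 p3)) == 0%N)).
- by rewrite -E; ring.
- have : oddz ((x + y) * (x + y)).
    have -> : (x + y) * (x + y) = d%:Z + 2 * (x * y - z * z) by rewrite -E; ring.
    by move: dz; rewrite /oddz; lia.
  by rewrite oddzM andbb.
- by rewrite /oddz; lia.
- move=> p1 p2 p3 q1 q2 q3 pq.
  have pq_adj : @adj (dist_graph (int_lattice R 3) (Num.sqrt ((2 * d)%N%:R : R)))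
      (P p1 p2 p3) (P q1 q2 q3).
    apply/(edist_int (f := vec p1 p2 p3) (g := vec q1 q2 q3)).
    - by move=> i; rewrite mxE.
    - by move=> i; rewrite mxE.
    by rewrite !big_ord_recl big_ord0 /= addr0 addrA.
  (* With fewer than three colours, a colour is determined by whether it is 0. *)
  apply/negP => /eqP Epq; apply: (cP _ _ pq_adj); apply: val_inj.
  by move: Epq (ltn_ord (c (P p1 p2 p3))) (ltn_ord (c (P q1 q2 q3))) => /=; lia.
Qed.
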